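(* Let $A$ be an integral matrix with $n$ columns and $m$ linearly independent rows, let $S\subseteq\mathbb{R}^n$ be a polyhedron, and let $$Q=\{x\in\mathbb{R}^n : x\in S,\ Ax=b\},\qquad \hat Q=\{\lambda\in\mathbb{R}^{n-m} : V\lambda+x_b\in S\},$$ where $V$ is a basis matrix of $\{v\in\mathbb{Z}^n : Av=0\}$ (its $n-m$ columns form a basis of this lattice), and $x_b\in\mathbb{Z}^n$ satisfies $Ax_b=b$. If $c\in\mathbb{Z}^n$ is a row vector, then 1. $\max\{cx : x\in Q\}=cx_b+\max\{cV\lambda : \lambda\in\hat Q\}$, with $x^*$ attaining the maximum in $Q$ if and only if $\lambda^*$ attains it in $\hat Q$, where $x^*=V\lambda^*+x_b$. 2. $\operatorname{width}(c,Q)=\operatorname{width}(cV,\hat Q)$. 3. $\operatorname{iwidth}(c,Q)=\operatorname{iwidth}(cV,\hat Q)$.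
   Context: For a polyhedron $Q$ and an integral vector $c$, $$\operatorname{width}(c,Q)=\max\{cx : x\in Q\}-\min\{cx : x\in Q\},$$ $$\operatorname{iwidth}(c,Q)=\lfloor\max\{cx : x\in Q\}\rfloor-\lceil\min\{cx : x\in Q\}\rceil+1.$$ *)

(* Defs.v *)
From HB Require Import structures.
From mathcomp Require Import all_boot all_order all_algebra.
From mathcomp Require Import boolp classical_sets reals constructive_ereal ereal.

Set Implicit Arguments.
Unset Strict Implicit.
Unset Printing Implicit Defensive.

Import Order.TTheory GRing.Theory Num.Theory.

Local Open Scope classical_set_scope.
Local Open Scope ring_scope.

Definition intrmx (R : realType) (m n : nat) (M : 'M[int]_(m, n)) : 'M[R]_(m, n) :=
  map_mx intr M.
Arguments intrmx R {m n} M.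

Definition polyhedron (R : realType) (n : nat) (S : set 'cV[R]_n) : Prop :=
  exists (k : nat) (G : 'M[R]_(k, n)) (h : 'cV[R]_k),
    S = [set x | forall i, (G *m x) i 0 <= h i 0].

Definition kernel_lattice (m n : nat) (A : 'M[int]_(m, n)) : set 'cV[int]_n :=
  [set v | A *m v = 0].

(* The columns of [V] are linearly independent, and their integral combinations
   are exactly the elements of [L]. *)
Definition lattice_basis (R : realType) (n k : nat) (L : set 'cV[int]_n)
    (V : 'M[int]_(n, k)) : Prop :=
  row_free (intrmx R V)^T /\
  L = [set V *m z | z in [set: 'cV[int]_k]].
Arguments lattice_basis R {n k} L V.

Definition linform (R : realType) (n : nat) (c : 'rV[int]_n) (x : 'cV[R]_n) : R :=
  (intrmx R c *m x) 0 0.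

Definition is_max (R : realType) (E : set R) (M : R) : Prop :=
  E M /\ ubound E M.

Definition is_min (R : realType) (E : set R) (M : R) : Prop :=
  E M /\ lbound E M.

(* Usual optimization conventions when no optimum exists: a maximum is [-oo] over
   the empty set and [+oo] otherwise, and dually for a minimum. The values of a
   linear form on a nonempty polyhedron have no maximum only if they are unbounded
   above, so [+oo] is then the usual value. *)
Definition maxval (R : realType) (E : set R) : \bar R :=
  if `[< E = set0 >] then -oo%E else xget +oo%E [set M%:E | M in is_max E].

Definition minval (R : realType) (E : set R) : \bar R :=
  if `[< E = set0 >] then +oo%E else xget -oo%E [set M%:E | M in is_min E].

Definition attains_max (R : realType) (n : nat) (c : 'rV[int]_n)
    (Q : set 'cV[R]_n) (x : 'cV[R]_n) : Prop :=
  Q x /\ is_max [set linform c y | y in Q] (linform c x).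

(* The difference never has the form [+oo - +oo] or [-oo - -oo]; it is [-oo] when
   [Q] is empty. The same holds for [iwidth]. *)
Definition width (R : realType) (n : nat) (c : 'rV[int]_n) (Q : set 'cV[R]_n) :
    \bar R :=
  (maxval [set linform c x | x in Q] - minval [set linform c x | x in Q])%E.

Definition iwidth (R : realType) (n : nat) (c : 'rV[int]_n) (Q : set 'cV[R]_n) :
    \bar int :=
  (er_map Num.floor (maxval [set linform c x | x in Q])
   - er_map Num.ceil (minval [set linform c x | x in Q]) + 1)%E.

(* Main.v *)
Require Import Defs.
From HB Require Import structures.
From mathcomp Require Import all_boot all_order all_algebra.
From mathcomp Require Import boolp classical_sets reals constructive_ereal ereal.

Set Implicit Arguments.
Unset Strict Implicit.
Unset Printing Implicit Defensive.

Import Order.TTheory GRing.Theory Num.Theory.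

Local Open Scope classical_set_scope.
Local Open Scope ring_scope.

(** The map [l |-> V l + xb] carries [Qhat] onto [Q].  Its values satisfy
    [A x = b] because the columns of [V] lie in the kernel of [A].  Conversely,
    if [A x = b], then [x - xb] lies in the real kernel of [A]; that kernel has
    dimension [n - m] and contains the [n - m] linearly independent columns of
    [V], so it is the real column space of [V] ([ker_eq_colspace]).

    Along this map the objective is translated by a constant:
    [c (V l + xb) = c xb + (c V) l].  So the set of values of [c] on [Q] is the
    set of values of [c V] on [Qhat] translated by [c xb] ([linform_image]).
    Maxima and minima follow the translation ([optimum_shift]), including the
    infinite values, which a finite translation fixes.  In the width the
    constant cancels ([sub_shift]).  In the integer width it cancels as well,
    since [c xb] is an integer and therefore passes through the rounding. *)

Section Translation.
Variable R : realType.
Implicit Types (E : set R) (a M : R).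

Lemma shiftK a E : [set - a + y | y in [set a + x | x in E]] = E.
Proof.
rewrite image_comp -[RHS]image_id; apply: eq_imagel => x _ /=.
by rewrite addKr.
Qed.

Lemma is_max_uniq E M N : is_max E M -> is_max E N -> M = N.
Proof.
by move=> [EM uM] [EN uN]; apply/le_anti; rewrite uN // uM.
Qed.

Lemma is_min_uniq E M N : is_min E M -> is_min E N -> M = N.
Proof.
by move=> [EM lM] [EN lN]; apply/le_anti; rewrite lM // lN.
Qed.

Lemma is_max_shift a E M : is_max E M -> is_max [set a + x | x in E] (a + M).
Proof.
move=> [EM uM]; split; first by exists M.
by move=> _ [x Ex <-]; rewrite lerD2l uM.
Qed.

Lemma is_min_shift a E M : is_min E M -> is_min [set a + x | x in E] (a + M).
Proof.
move=> [EM lM]; split; first by exists M.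
by move=> _ [x Ex <-]; rewrite lerD2l lM.
Qed.

Lemma is_max_shiftE a E M :
  is_max [set a + x | x in E] (a + M) <-> is_max E M.
Proof.
split=> [/(is_max_shift (- a))|]; last exact: is_max_shift.
by rewrite shiftK addKr.
Qed.

(** Maxima and minima are both a unique, translation-equivariant kind [P] of
    optimum, completed by a value [e0] for the empty set and a value [e1] for a
    missing optimum.  Translation keeps the three cases apart, and it fixes [e0]
    and [e1] because these are infinite. *)
Lemma optimum_shift (P : set R -> R -> Prop) (e0 e1 : \bar R) a E :
  (forall E M N, P E M -> P E N -> M = N) ->
  (forall a E M, P E M -> P [set a + x | x in E] (a + M)) ->
  (a%:E + e0 = e0)%E -> (a%:E + e1 = e1)%E ->
  let opt F := if `[< F = set0 >] then e0 else xget e1 [set M%:E | M in P F] in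
  opt [set a + x | x in E] = (a%:E + opt E)%E.
Proof.
move=> Puniq Pshift ae0 ae1 /=.
have xgetE F M : P F M -> xget e1 [set N%:E | N in P F] = M%:E.
  move=> PM; case: xgetP => [_ -> [N PN <-]|/(_ M%:E)[]]; last by exists M.
  by rewrite (Puniq _ _ _ PN PM).
have xgetN F : ~ (exists M, P F M) -> xget e1 [set N%:E | N in P F] = e1.
  by move=> noM; apply: xgetPN => _ [M PM _]; apply: noM; exists M.
case: asboolP => [sE0|sEN0]; case: asboolP => [E0|EN0].
- by rewrite ae0.
- by case: EN0; rewrite -(shiftK a E) sE0 image_set0.
- by case: sEN0; rewrite E0 image_set0.
have [[M PM]|noM] := pselect (exists M, P E M).
  by rewrite (xgetE _ _ PM) (xgetE _ _ (Pshift a _ _ PM)).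
rewrite (xgetN _ noM) xgetN ?ae1 // => -[M /(Pshift (- a))].
by rewrite shiftK => PM; apply: noM; exists (- a + M).
Qed.

Lemma maxval_shift a E : maxval [set a + x | x in E] = (a%:E + maxval E)%E.
Proof.
exact: (optimum_shift _ is_max_uniq is_max_shift).
Qed.

Lemma minval_shift a E : minval [set a + x | x in E] = (a%:E + minval E)%E.
Proof.
exact: (optimum_shift _ is_min_uniq is_min_shift).
Qed.

(** Rounding commutes with an integer translation, also at the infinite values,
    which [er_map] leaves alone. *)
Lemma er_floor_shift (z : int) (e : \bar R) :
  er_map Num.floor (z%:~R%:E + e)%E = (z%:E + er_map Num.floor e)%E.
Proof.
by case: e => //= r; rewrite floorDzr ?intr_int // intrKfloor.
Qed.

Lemma er_ceil_shift (z : int) (e : \bar R) :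
  er_map Num.ceil (z%:~R%:E + e)%E = (z%:E + er_map Num.ceil e)%E.
Proof.
by case: e => //= r; rewrite ceilDzr ?intr_int // intrKceil.
Qed.

End Translation.

Lemma sub_shift (K : numDomainType) (a : K) (x y : \bar K) :
  ((a%:E + x) - (a%:E + y) = x - y)%E.
Proof.
case: x y => [x| |] [y| |] //=.
by congr EFin; rewrite opprD addrACA subrr add0r.
Qed.

Lemma intrmxM (R : realType) (m n p : nat) (M : 'M[int]_(m, n))
    (N : 'M[int]_(n, p)) : intrmx R (M *m N) = intrmx R M *m intrmx R N.
Proof. exact: map_mxM. Qed.

Lemma linform_int (R : realType) (n : nat) (c : 'rV[int]_n) (z : 'cV[int]_n) :
  linform c (intrmx R z) = ((c *m z) 0 0)%:~R.
Proof. by rewrite /linform -intrmxM mxE. Qed.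

Lemma linform_affine (R : realType) (n k : nat) (c : 'rV[int]_n)
    (V : 'M[int]_(n, k)) (l : 'cV[R]_k) (x : 'cV[R]_n) :
  linform c (intrmx R V *m l + x) = linform c x + linform (c *m V) l.
Proof.
by rewrite /linform mulmxDr mxE addrC intrmxM mulmxA.
Qed.

Section KernelParametrization.
Variables (R : realType) (m n : nat) (A : 'M[int]_(m, n)).
Variable V : 'M[int]_(n, n - m).
Hypothesis V_basis : lattice_basis R (kernel_lattice A) V.

(** Each column of [V] is [V] times a unit vector, so it lies in the lattice. *)
Lemma mul_kernel_basis : intrmx R A *m intrmx R V = 0.
Proof.
have [_ LV] := V_basis.
rewrite -intrmxM; suff -> : A *m V = 0 by apply: map_mx0.
apply/matrixP => i j.
have : kernel_lattice A (V *m delta_mx j 0) by rewrite LV; exists (delta_mx j 0).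
by rewrite /kernel_lattice /= mulmxA -colE => /matrixP/(_ i 0); rewrite !mxE.
Qed.

(** The columns of [V] span a subspace of the kernel of [A] of the same
    dimension [n - m], hence the whole kernel. *)
Lemma ker_eq_colspace (A_free : row_free (intrmx R A)) (v : 'cV[R]_n) :
  intrmx R A *m v = 0 -> exists l, v = intrmx R V *m l.
Proof.
have [V_free _] := V_basis => Av0.
have VK : ((intrmx R V)^T <= kermx (intrmx R A)^T)%MS.
  by apply/sub_kermxP; rewrite -trmx_mul mul_kernel_basis trmx0.
have rankE : \rank (intrmx R V)^T = \rank (kermx (intrmx R A)^T).
  by rewrite mxrank_ker (mxrank_tr (intrmx R A)) (eqP A_free) (eqP V_free).
have /eqmxP VKE : ((intrmx R V)^T == kermx (intrmx R A)^T)%MS.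
  by rewrite -(mxrank_leqif_eq VK) rankE.
have /submxP[l vE] : (v^T <= (intrmx R V)^T)%MS.
  by rewrite VKE; apply/sub_kermxP; rewrite -trmx_mul Av0 trmx0.
by exists l^T; rewrite -[v]trmxK vE trmx_mul trmxK.
Qed.

End KernelParametrization.

Lemma linform_image (R : realType) (n k : nat) (c : 'rV[int]_n)
    (V : 'M[int]_(n, k)) (x0 : 'cV[R]_n) (Qhat : set 'cV[R]_k) :
  [set linform c x | x in [set intrmx R V *m l + x0 | l in Qhat]]
    = [set linform c x0 + y | y in [set linform (c *m V) l | l in Qhat]].
Proof.
by rewrite !image_comp; apply: eq_imagel => l _ /=; exact: linform_affine.
Qed.

Theorem theorem8 (R : realType) (m n : nat) (A : 'M[int]_(m, n))
    (A_free : row_free (intrmx R A))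
    (S : set 'cV[R]_n) (S_poly : polyhedron S)
    (b : 'cV[R]_m) (V : 'M[int]_(n, n - m))
    (V_basis : lattice_basis R (kernel_lattice A) V)
    (xb : 'cV[int]_n) (Axb : intrmx R A *m intrmx R xb = b)
    (c : 'rV[int]_n) :
  let Q : set 'cV[R]_n := [set x | S x /\ intrmx R A *m x = b] in
  let Qhat : set 'cV[R]_(n - m) :=
    [set l | S (intrmx R V *m l + intrmx R xb)] in
  [/\ [/\ maxval [set linform c x | x in Q]
            = ((linform c (intrmx R xb))%:E
               + maxval [set linform (c *m V) l | l in Qhat])%E,
          forall (x : 'cV[R]_n) (l : 'cV[R]_(n - m)),
            x = intrmx R V *m l + intrmx R xb ->
            (attains_max c Q x <-> attains_max (c *m V) Qhat l)
        & forall x : 'cV[R]_n, attains_max c Q x ->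
            exists l : 'cV[R]_(n - m), x = intrmx R V *m l + intrmx R xb],
      width c Q = width (c *m V) Qhat
    & iwidth c Q = iwidth (c *m V) Qhat].
Proof.
move=> Q Qhat.
have QE l : Q (intrmx R V *m l + intrmx R xb) <-> Qhat l.
  split=> [[]//|Sl]; split=> //.
  by rewrite mulmxDr mulmxA (mul_kernel_basis V_basis) mul0mx add0r.
have Qparam x : Q x -> exists l, x = intrmx R V *m l + intrmx R xb.
  move=> [_ Ax]; have Ad0 : intrmx R A *m (x - intrmx R xb) = 0.
    by rewrite mulmxBr Ax Axb subrr.
  by have [l xE] := ker_eq_colspace V_basis A_free Ad0; exists l; rewrite -xE subrK.
have Qimage : Q = [set intrmx R V *m l + intrmx R xb | l in Qhat].
  rewrite eqEsubset; split=> [x Qx|_ [l Ql <-]]; last exact/QE.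
  by have [l xE] := Qparam _ Qx; exists l => //; apply/QE; rewrite -xE.
have valE : [set linform c x | x in Q] = [set linform c (intrmx R xb) + y
    | y in [set linform (c *m V) l | l in Qhat]].
  by rewrite Qimage linform_image.
split.
- split; first by rewrite valE maxval_shift.
  + move=> _ l ->; rewrite /attains_max valE linform_affine.
    split=> -[Ql Ml]; split; try exact/QE.
    * exact: (is_max_shiftE _ _ _).1 Ml.
    * exact: is_max_shift.
  + by move=> x [Qx _]; exact: Qparam.
- by rewrite /width valE maxval_shift minval_shift sub_shift.
- rewrite /iwidth valE maxval_shift minval_shift linform_int.
  by rewrite er_floor_shift er_ceil_shift sub_shift.
Qed.
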